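(* Suppose $T$ is weakly quasi-o-minimal with respect to an $L$-definable linear order $<$, and let $\preccurlyeq$ be an $L$-definable total preorder on $\mathfrak C$, with $E_\preccurlyeq(x,y)$ the equivalence relation $x\preccurlyeq y\wedge y\preccurlyeq x$. Then there are an $L$-definable partition $\mathfrak C=D_1\cup\dots\cup D_n$ and orders $<_{\vec E_1},\dots,<_{\vec E_n}\in\mathcal W_T$ such that for each $i=1,\dots,n$ and all $x,y\in D_i$: $x\preccurlyeq y$ if and only if $E_\preccurlyeq(x,y)\vee(\neg E_\preccurlyeq(x,y)\wedge x<_{\vec E_i}y)$. If in addition $\preccurlyeq$ is a linear order, then $\preccurlyeq$ agrees with $<_{\vec E_i}$ on $D_i$ for all $i=1,\dots,n$.
   Context: Work in a monster model $\mathfrak C$ of the complete theory $T$; ''$L$-definable'' means definable without parameters. $T$ is weakly quasi-o-minimal with respect to $<$ if every subset of a model of $T$ definable with parameters is a finite Boolean combination of $<$-convex sets (not necessarily definable) and $L$-definable sets. For a convex equivalence relation $E$ on $(\mathfrak C,<)$, $x<_E y$ iff ($E(x,y)$ and $y<x$) or ($\neg E(x,y)$ and $x<y$); for $\vec E=(E_0,\dots,E_{m-1})$ put $<_{\vec E}=(\dots((<_{E_0})_{E_1})\dots)_{E_{m-1}}$. $\mathcal W_T$ is the set of all $<_{\vec E}$ where $\vec E$ is a finite sequence of $L$-definable $<$-convex equivalence relations with $E_{j+1}\subseteq E_j$ for all $j$. *)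

(* Defs.v *)
(* MathComp and its classical layer *)
From Stdlib Require Export RelationClasses.
From mathcomp Require Export all_boot.
From mathcomp Require Export boolp classical_sets functions cardinality.

Set Implicit Arguments.
Unset Strict Implicit.
Unset Printing Implicit Defensive.

Local Open Scope classical_set_scope.
Local Open Scope card_scope.

Record language := Language {
  fsym : Type;
  farity : fsym -> nat;
  rsym : Type;
  rarity : rsym -> nat }.

(* [term L n] and [formula L n]: free variables among x_0, ..., x_(n-1).      *)
Inductive term (L : language) (n : nat) : Type :=
  | TVar of 'I_n
  | TApp (f : fsym L) of ('I_(farity f) -> term L n).

(* [FAll] binds x_0 of its body; x_(i+1) of the body is x_i of the result.    *)
Inductive formula (L : language) (n : nat) : Type :=
  | FBot
  | FEq of term L n & term L n
  | FRel (r : rsym L) of ('I_(rarity r) -> term L n)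
  | FImp of formula L n & formula L n
  | FAll of formula L n.+1.

Arguments FBot {L n}.

Definition FNot (L : language) (n : nat) (phi : formula L n) : formula L n :=
  FImp phi FBot.

Definition scons (A : Type) (n : nat) (a : A) (v : 'I_n -> A) : 'I_n.+1 -> A :=
  fun i => if unlift ord0 i is Some j then v j else a.

Record structure (L : language) := Structure {
  carrier :> Type;
  carrier_inhabited : inhabited carrier;
  finterp : forall f : fsym L, ('I_(farity f) -> carrier) -> carrier;
  rinterp : forall r : rsym L, ('I_(rarity r) -> carrier) -> Prop }.

Fixpoint teval (L : language) (M : structure L) (n : nat) (v : 'I_n -> M)
    (t : term L n) : M :=
  match t with
  | TVar i => v i
  | TApp f ts => finterp (fun i => teval v (ts i))
  end.

Fixpoint sat (L : language) (M : structure L) (n : nat) (phi : formula L n) :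
    ('I_n -> M) -> Prop :=
  match phi with
  | FBot => fun=> False
  | FEq s t => fun v => teval v s = teval v t
  | FRel r ts => fun v => rinterp (fun i => teval v (ts i))
  | FImp psi chi => fun v => sat psi v -> sat chi v
  | FAll psi => fun v => forall a : M, sat psi (scons a v)
  end.

Definition holds (L : language) (M : structure L) (phi : formula L 0) : Prop :=
  forall v : 'I_0 -> M, sat phi v.

Definition theory (L : language) := set (formula L 0).

Definition model (L : language) (M : structure L) (T : theory L) : Prop :=
  forall phi, T phi -> holds M phi.

Definition entails (L : language) (T : theory L) (phi : formula L 0) : Prop :=
  forall M : structure L, model M T -> holds M phi.

Definition complete_theory (L : language) (T : theory L) : Prop :=
  (exists M : structure L, model M T) /\
  (forall phi, entails T phi \/ entails T (FNot phi)).

Definition definable (L : language) (M : structure L) (n : nat)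
    (X : set ('I_n -> M)) : Prop :=
  exists phi : formula L n, forall v, X v <-> sat phi v.

Definition definable1 (L : language) (M : structure L) (X : set M) : Prop :=
  definable (fun v : 'I_1 -> M => X (v ord0)).

Definition definable2 (L : language) (M : structure L) (R : M -> M -> Prop) :
    Prop :=
  definable (fun v : 'I_2 -> M => R (v ord0) (v ord_max)).

Definition definable_with_parameters (L : language) (M : structure L)
    (X : set M) : Prop :=
  exists (k : nat) (b : 'I_k -> M) (phi : formula L k.+1),
    forall a, X a <-> sat phi (scons a b).

Definition relation_of (L : language) (M : structure L) (phi : formula L 2) :
    M -> M -> Prop :=
  fun x y => sat phi (scons x (fun _ : 'I_1 => y)).

(* A cardinal is represented by a type [K] having it as its cardinality.      *)
Definition card_lt (U : Type) (A : set U) (K : Type) : Prop :=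
  (A #<= [set: K]) /\ ~ ([set: K] #<= A).

Record pformula (L : language) (M : structure L) := PFormula {
  pf_size : nat;
  pf_formula : formula L pf_size.+1;
  pf_param : 'I_pf_size -> M }.

Arguments pf_param {L M} p _.

Definition psat (L : language) (M : structure L) (phi : pformula M) (a : M) :
    Prop :=
  sat (pf_formula phi) (scons a (pf_param phi)).

Definition pf_over (L : language) (M : structure L) (A : set M)
    (phi : pformula M) : Prop :=
  forall i, A (pf_param phi i).

Definition saturated (K : Type) (L : language) (M : structure L) : Prop :=
  forall (A : set M) (p : set (pformula M)),
    card_lt A K ->
    p `<=` pf_over A ->
    (forall q : set (pformula M), finite_set q -> q `<=` p ->
       exists a, forall phi, q phi -> psat phi a) ->
    exists a, forall phi, p phi -> psat phi a.

Definition automorphism (L : language) (M : structure L) (g : M -> M) : Prop :=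
  [/\ bijective g,
      forall (f : fsym L) v, g (finterp (f := f) v) = finterp (f := f) (g \o v)
    & forall (r : rsym L) v,
        rinterp (r := r) v <-> rinterp (r := r) (g \o v)].

Definition elementary_on (L : language) (M : structure L) (A : set M)
    (f : M -> M) : Prop :=
  forall (n : nat) (phi : formula L n) (b : 'I_n -> M),
    (forall i, A (b i)) -> (sat phi b <-> sat phi (f \o b)).

Definition strongly_homogeneous (K : Type) (L : language) (M : structure L) :
    Prop :=
  forall (A : set M) (f : M -> M),
    card_lt A K -> elementary_on A f ->
    exists g, automorphism g /\ forall a, A a -> g a = f a.

(* The number of formulas is |L| + aleph_0. Any saturated model of            *)
(* cardinality [K] > |L| + aleph_0 is monster in this sense.                  *)
Definition monster (L : language) (M : structure L) : Prop :=
  exists K : Type,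
    [/\ card_lt [set: {n : nat & formula L n}] K,
        saturated K M & strongly_homogeneous K M].

Definition strict_linear_order (X : Type) (R : X -> X -> Prop) : Prop :=
  StrictOrder R /\ forall x y, [\/ R x y, x = y | R y x].

Definition total_preorder (X : Type) (R : X -> X -> Prop) : Prop :=
  PreOrder R /\ forall x y, R x y \/ R y x.

Definition linear_order (X : Type) (R : X -> X -> Prop) : Prop :=
  total_preorder R /\ forall x y, R x y -> R y x -> x = y.

Definition preorder_equiv (X : Type) (R : X -> X -> Prop) : X -> X -> Prop :=
  fun x y => R x y /\ R y x.

Definition convex (X : Type) (R : X -> X -> Prop) (C : set X) : Prop :=
  forall x y z, C x -> C z -> R x y -> R y z -> C y.

Inductive boolean_combination (X : Type) (G : set (set X)) : set X -> Prop :=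
  | bc_base A of G A : boolean_combination G A
  | bc_compl A of boolean_combination G A : boolean_combination G (~` A)
  | bc_union A B of boolean_combination G A & boolean_combination G B :
      boolean_combination G (A `|` B)
  | bc_inter A B of boolean_combination G A & boolean_combination G B :
      boolean_combination G (A `&` B).

Definition weakly_quasi_o_minimal (L : language) (T : theory L)
    (lt : formula L 2) : Prop :=
  forall M : structure L, model M T ->
  forall X : set M, definable_with_parameters X ->
  boolean_combination
    [set A : set M | convex (relation_of lt) A \/ definable1 A] X.

Definition convex_equivalence (X : Type) (R E : X -> X -> Prop) : Prop :=
  Equivalence E /\ forall x, convex R (E x).

Definition twist (X : Type) (R E : X -> X -> Prop) : X -> X -> Prop :=
  fun x y => (E x y /\ R y x) \/ (~ E x y /\ R x y).

Definition twists (X : Type) (R : X -> X -> Prop) (m : nat)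
    (E : 'I_m -> X -> X -> Prop) : X -> X -> Prop :=
  foldl (fun S i => twist S (E i)) R (enum 'I_m).

Definition twisted_orders (L : language) (M : structure L)
    (R : M -> M -> Prop) : set (M -> M -> Prop) :=
  [set S | exists (m : nat) (E : 'I_m -> M -> M -> Prop),
    [/\ forall j, definable2 (E j),
        forall j, convex_equivalence R (E j),
        forall (i j : 'I_m) x y, j = i.+1 :> nat -> E j x y -> E i x y
      & S = twists R E]].

(* Main.v *)
(* Fix a point [a0] and let X be the set of realizations of its type over the
   empty set; automorphisms act transitively on X, and weak quasi-o-minimality
   gives a definable D0 containing X on which every cut {x <= a}, a in X, of the
   preorder changes truth value a bounded number of times along increasing
   sequences.  Inside a class of a definable convex equivalence E, let f(a) be
   the supremum (for the linear order) of the cut at a.  By transitivity and the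
   bound, f is nondecreasing on X.  If f(a) is below the right end of the class,
   the fibres of f form a finer convex equivalence F, outside of which the
   preorder agrees with the linear order, and the number of changes to the right
   of a inside its F-class is smaller than inside its E-class.  If the same holds
   for the reversed preorder, one obtains such an F with reversed orders; if
   neither holds, then E is contained in the equivalence of the preorder on X.
   Iterating this finitely often gives the twisted order on X, and compactness
   spreads it to a definable neighbourhood of [a0], then to a finite cover. *)
From Stdlib Require List.
Require Import Defs.

Set Implicit Arguments.
Unset Strict Implicit.
Unset Printing Implicit Defensive.

Local Open Scope classical_set_scope.

(** * Definable sets *)

Section Definability.
Variables (L : language) (M : structure L).

Lemma scons0 (A : Type) (n : nat) (a : A) (v : 'I_n -> A) :
  scons a v ord0 = a.
Proof. by rewrite /scons unlift_none. Qed.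

Lemma scons_lift (A : Type) (n : nat) (a : A) (v : 'I_n -> A) :
  scons a v \o lift ord0 = v.
Proof. by apply/funext => i; rewrite /scons /= liftK. Qed.

Fixpoint trename m n (s : 'I_m -> 'I_n) (t : term L m) : term L n :=
  match t with
  | TVar i => TVar L (s i)
  | TApp f ts => TApp (fun i => trename s (ts i))
  end.

Definition rlift m n (s : 'I_m -> 'I_n) : 'I_m.+1 -> 'I_n.+1 :=
  scons ord0 (lift ord0 \o s).

Fixpoint frename m (phi : formula L m) : forall n, ('I_m -> 'I_n) -> formula L n :=
  match phi with
  | FBot => fun _ _ => FBot
  | FEq t u => fun _ s => FEq (trename s t) (trename s u)
  | FRel r ts => fun _ s => FRel (fun i => trename s (ts i))
  | FImp psi chi => fun _ s => FImp (frename psi s) (frename chi s)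
  | FAll psi => fun _ s => FAll (frename psi (rlift s))
  end.

Lemma teval_rename m n (s : 'I_m -> 'I_n) (v : 'I_n -> M) t :
  teval v (trename s t) = teval (v \o s) t.
Proof. by elim: t => //= f ts IH; congr finterp; apply/funext => i. Qed.

Lemma sat_rename m (phi : formula L m) n (s : 'I_m -> 'I_n) (v : 'I_n -> M) :
  sat (frename phi s) v <-> sat phi (v \o s).
Proof.
elim: phi n s v => //= {m}[m t u|m r ts|m p IHp q IHq|m p IH] n s v.
- by rewrite !teval_rename.
- by rewrite (_ : (fun i => _) = (fun i => teval (v \o s) (ts i)))//;
    apply/funext => i; rewrite teval_rename.
- by split=> h /IHp /h /IHq.
- have e a : scons a v \o rlift s = scons a (v \o s).
    apply/funext => i; rewrite /= /rlift.
    by case: (unliftP ord0 i) => [j|] ->; rewrite /scons ?liftK ?unlift_none.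
  by split=> h a; move: (h a); rewrite IH e.
Qed.

Lemma definable_ext n (P Q : ('I_n -> M) -> Prop) :
  (forall v, P v <-> Q v) -> definable P -> definable Q.
Proof. by move=> PQ [phi h]; exists phi => v; rewrite -PQ. Qed.

Lemma definable_rename m n (s : 'I_m -> 'I_n) (P : ('I_m -> M) -> Prop) :
  definable P -> definable (fun v : 'I_n -> M => P (v \o s)).
Proof. by move=> [phi h]; exists (frename phi s) => v; rewrite sat_rename h. Qed.

Lemma definable_imp n (P Q : ('I_n -> M) -> Prop) :
  definable P -> definable Q -> definable (fun v => P v -> Q v).
Proof.
by move=> [p hp] [q hq]; exists (FImp p q) => v /=; split=> h /hp /h /hq.
Qed.

Lemma definable_False n : definable (fun _ : 'I_n -> M => False).
Proof. by exists FBot. Qed.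

Lemma definable_not n (P : ('I_n -> M) -> Prop) :
  definable P -> definable (fun v => ~ P v).
Proof. by move=> dP; apply: definable_imp => //; exact: definable_False. Qed.

Lemma definable_True n : definable (fun _ : 'I_n -> M => True).
Proof. by exists (FNot FBot) => v /=; split. Qed.

Lemma definable_and n (P Q : ('I_n -> M) -> Prop) :
  definable P -> definable Q -> definable (fun v => P v /\ Q v).
Proof.
move=> dP dQ.
apply: (@definable_ext _ (fun v => ~ (P v -> ~ Q v))) => [v|].
  split=> [h|[p q] h]; last exact: h.
  apply: contrapT => nh; apply: h => p q.
  exact: nh.
by apply: definable_not; apply: definable_imp => //; exact: definable_not.
Qed.

Lemma definable_or n (P Q : ('I_n -> M) -> Prop) :
  definable P -> definable Q -> definable (fun v => P v \/ Q v).
Proof.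
move=> dP dQ; apply: (@definable_ext _ (fun v => ~ P v -> Q v)) => [v|].
  by split=> [h|[p|q] np //]; have [p|np] := pselect (P v); [left|right; apply: h].
by apply: definable_imp => //; exact: definable_not.
Qed.

Lemma definable_iff n (P Q : ('I_n -> M) -> Prop) :
  definable P -> definable Q -> definable (fun v => P v <-> Q v).
Proof. by move=> dP dQ; apply: definable_and; exact: definable_imp. Qed.

Lemma definable_all n (P : M -> ('I_n -> M) -> Prop) :
  definable (fun w : 'I_n.+1 -> M => P (w ord0) (fun i => w (lift ord0 i))) ->
  definable (fun v => forall a, P a v).
Proof.
move=> [phi h]; exists (FAll phi) => v /=.
have e a : P a v <-> sat phi (scons a v).
  by rewrite -h scons0 (_ : (fun i => _) = scons a v \o lift ord0)// scons_lift.
by split=> H a; apply/e.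
Qed.

Lemma definable_ex n (P : M -> ('I_n -> M) -> Prop) :
  definable (fun w : 'I_n.+1 -> M => P (w ord0) (fun i => w (lift ord0 i))) ->
  definable (fun v => exists a, P a v).
Proof.
move=> dP; apply: (@definable_ext _ (fun v => ~ forall a, ~ P a v)) => [v|].
  split=> [h|[a Pa] /(_ a)//]; apply: contrapT => nP; apply: h => a Pa.
  by apply: nP; exists a.
by apply: definable_not; apply: definable_all; exact: definable_not.
Qed.

Lemma definable_set1 n (D : M -> Prop) (i : 'I_n) :
  definable1 (M := M) D -> definable (fun v : 'I_n -> M => D (v i)).
Proof. exact: (definable_rename (fun=> i)). Qed.

Lemma definable_rel2 n (R : M -> M -> Prop) (i j : 'I_n) :
  definable2 R -> definable (fun v : 'I_n -> M => R (v i) (v j)).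
Proof.
move=> /(definable_rename (fun k => if k == ord0 then i else j)).
exact: definable_ext.
Qed.

Lemma definable_relation_of (phi : formula L 2) :
  definable2 (relation_of (M := M) phi).
Proof.
exists phi => v; rewrite /relation_of (_ : scons _ _ = v)//.
apply/funext => i; rewrite /scons; case: (unliftP ord0 i) => [j|] -> //.
by congr v; apply/val_inj; rewrite (ord1 j).
Qed.

Lemma automorphism_teval (g : M -> M) n (v : 'I_n -> M) t :
  automorphism g -> g (teval v t) = teval (g \o v) t.
Proof.
move=> [_ gf _]; elim: t => //= f ts IH; rewrite gf; congr finterp.
by apply/funext => i /=.
Qed.

Lemma automorphism_sat (g : M -> M) n (phi : formula L n) (v : 'I_n -> M) :
  automorphism g -> sat phi v <-> sat phi (g \o v).
Proof.
move=> ag; have [bg _ gr] := ag.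
elim: phi v => //= {n}[n t u|n r ts|n p IHp q IHq|n p IH] v.
- by rewrite -!automorphism_teval//; split=> [->//|/(bij_inj bg)].
- rewrite gr (_ : _ \o _ = fun i => teval (g \o v) (ts i))//.
  by apply/funext => i /=; rewrite automorphism_teval.
- by rewrite IHp IHq.
- have e a : g \o scons a v = scons (g a) (g \o v).
    by apply/funext => i; rewrite /= /scons; case: (unliftP ord0 i).
  have [f fK gK] := bg.
  split=> h a; last by apply/IH; rewrite e.
  by have /IH := h (f a); rewrite e gK.
Qed.

Lemma automorphism_definable1 (g : M -> M) (D : M -> Prop) x :
  automorphism g -> definable1 (M := M) D -> D x <-> D (g x).
Proof.
move=> ag [phi h].
by rewrite (h (fun=> x)) (h (fun=> g x)) (automorphism_sat _ _ ag).
Qed.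

Lemma automorphism_definable2 (g : M -> M) (R : M -> M -> Prop) x y :
  automorphism g -> definable2 R -> R x y <-> R (g x) (g y).
Proof.
move=> ag [phi h]; pose v (i : 'I_2) := if i == ord0 then x else y.
have := h v; have := h (g \o v).
by rewrite /= -(automorphism_sat _ _ ag) => -> ->.
Qed.

Lemma automorphism_inv (g : M -> M) :
  automorphism g -> exists f, [/\ automorphism f, cancel g f & cancel f g].
Proof.
move=> [[f fK gK] gf gr]; exists f; split=> //; split; first by exists g.
- move=> h v; apply: (can_inj fK); rewrite gK gf; congr finterp.
  by apply/funext => i /=; rewrite gK.
- move=> r v; rewrite [X in _ <-> X]gr (_ : g \o (f \o v) = v)//.
  by apply/funext => i /=; rewrite gK.
Qed.

End Definability.

(** * Saturation and homogeneity *)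

Section Monster.
Local Open Scope card_scope.
Variables (L : language) (M : structure L).

Lemma finite_card_lt (K : Type) (A : set M) :
  card_lt [set: {n : nat & formula L n}] K -> finite_set A -> card_lt A K.
Proof.
move=> [FK _] fA.
have natK : [set: nat] #<= [set: K].
  apply: card_le_trans FK.
  (* One formula [FBot] for each number of variables: there are infinitely many formulas, so [K] is
     infinite. *)
  pose f (n : nat) : {n : nat & formula L n} := existT _ n FBot.
  have fi : {in [set: nat] &, injective f} by move=> m n _ _ [].
  have := inj_card_eq fi; rewrite card_eq_le => /andP[_ h].
  exact: card_le_trans h (subset_card_le (subsetT _)).
split; first exact: card_le_trans (finite_set_countable fA) natK.
move=> /(card_le_trans natK)/card_le_finite/(_ fA).
exact: infinite_nat.
Qed.

Hypothesis mM : monster M.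

(** The form in which saturation is used: a directed family of nonempty sets, definable over one
    finite tuple [v], has a common point. The index type may be of any size, since only the
    parameters are counted. *)
Lemma monster_realize (I : Type) (k : nat) (v : 'I_k -> M)
    (W : I -> M -> ('I_k -> M) -> Prop) :
  inhabited I ->
  (forall i, definable
     (fun w : 'I_k.+1 -> M => W i (w ord0) (fun j => w (lift ord0 j)))) ->
  (forall i j, exists l, forall x, W l x v -> W i x v /\ W j x v) ->
  (forall i, exists x, W i x v) ->
  exists x, forall i, W i x v.
Proof.
move=> [i0] dW directed inh.
have [K [cK satM _]] := mM.
(* All formulas over [v] implied by some [W i]: by directedness, a single [W i] implies any finite
   part of [p]. *)
pose p (phi : pformula M) :=
  pf_over (range v) phi /\ exists i, forall x, W i x v -> psat phi x.
have [||a ha] := satM (range v) p (finite_card_lt cK (finite_image _ finite_finset)).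
- by move=> phi [].
- move=> q fq qp.
  have [i qi] : exists i, forall phi, q phi -> forall x, W i x v -> psat phi x.
    have /(@finite_seqP {classic pformula M})[s qs] := fq.
    have {qp} : [set` s] `<=` p by rewrite -qs.
    rewrite qs {q fq qs}; elim: s => [|phi s IH] sp; first by exists i0.
    have [|i hi] := IH; first by move=> psi /= h; apply: sp; rewrite /= inE h orbT.
    have [|_ [j hj]] := sp phi; first by rewrite /= inE eqxx.
    have [l hl] := directed i j; exists l => psi /=.
    by rewrite inE => /predU1P[->|h] x /hl[]; [move=> _ /hj|move=> /(hi _ h)].
  by have [x hx] := inh i; exists x => phi /qi; apply.
exists a => i; have [phi hphi] := dW i.
have e x : W i x v <-> sat phi (scons x v).
  by rewrite -hphi scons0 (_ : (fun j => _) = scons x v \o lift ord0)// scons_lift.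
apply/e; have /(_ (PFormula phi v)) := ha; apply.
split; first by move=> j /=; exists j.
by exists i => x /e.
Qed.

(** Passing to complements turns the inclusion of types into equality, so sending [a] to [b] is
    elementary on a singleton and extends by strong homogeneity. *)
Lemma monster_conjugate (a b : M) :
  (forall D : M -> Prop, definable1 (M := M) D -> D a -> D b) ->
  exists g, automorphism g /\ g a = b.
Proof.
move=> ab; have [K [cK _ homM]] := mM.
have {}ab D : definable1 (M := M) D -> D a <-> D b.
  move=> dD; split; first exact: ab.
  by apply: contraPP; apply: (ab (fun x => ~ D x)); exact: definable_not.
have [||g [ag ga]] := homM [set a] (fun=> b).
- exact: finite_card_lt cK (finite_set1 a).
- move=> n phi c ca.
  have -> : c = fun=> a by apply/funext => i; exact: ca.
  apply: (ab (fun x => sat phi (fun=> x))).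
  by apply: (definable_rename (fun=> ord0) (P := sat phi)); exists phi.
- by exists g; split=> //; exact: ga.
Qed.

End Monster.

(** * Alternations along increasing sequences *)

Section Changes.
Variables (T : Type) (lt : T -> T -> Prop).
Hypothesis lt_trans : forall x y z, lt x y -> lt y z -> lt x z.

Definition increasing (x : T) (s : seq T) : bool :=
  path (fun y z => `[< lt y z >]) x s.

Definition all_in (D : T -> Prop) (s : seq T) : bool := all (fun y => `[< D y >]) s.

Fixpoint changes (P : set T) (x : T) (s : seq T) : nat :=
  if s is y :: s' then (`[< P x >] != `[< P y >]) + changes P y s' else 0.

Definition changes_bounded (D P : set T) (N : nat) : Prop :=
  forall x s, D x -> all_in D s -> increasing x s -> changes P x s <= N.

Lemma changes_rcons P x s y :
  changes P x (rcons s y) = changes P x s + (`[< P (last x s) >] != `[< P y >]).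
Proof. by elim: s x => [|z s IH] x /=; rewrite ?addn0// IH addnA. Qed.

Lemma changesC P x s : changes (~` P) x s = changes P x s.
Proof.
by elim: s x => //= y s IH x; rewrite IH !asbool_neg; congr (_ + _);
  case: `[< P x >]; case: `[< P y >].
Qed.

Lemma changesU P Q x s : changes (P `|` Q) x s <= changes P x s + changes Q x s.
Proof.
elim: s x => //= y s IH x.
rewrite addnACA; apply: leq_add (IH y); rewrite !asbool_or.
by case: `[< P x >]; case: `[< P y >]; case: `[< Q x >]; case: `[< Q y >].
Qed.

Lemma changesI P Q x s : changes (P `&` Q) x s <= changes P x s + changes Q x s.
Proof.
by rewrite -changesC setCI -(changesC P) -(changesC Q); exact: changesU.
Qed.

Lemma changes_convex P x s : convex lt P -> increasing x s -> changes P x s <= 2.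
Proof.
move=> cP.
(* A convex set can be entered once and left once: [c0] forbids a return after leaving, [c1] allows
   one change when starting inside. *)
have c0 w y t : P w -> lt w y -> ~ P y -> increasing y t -> changes P y t = 0.
  elim: t y => //= z t IH y Pw wy nPy /andP[/asboolP yz zt].
  have nPz : ~ P z by move=> Pz; apply: nPy; exact: cP Pw Pz wy yz.
  rewrite (IH z) ?(asboolF nPy) ?(asboolF nPz)//; exact: lt_trans wy yz.
have c1 y t : P y -> increasing y t -> changes P y t <= 1.
  elim: t y => //= z t IH y Py /andP[/asboolP yz zt]; rewrite (asboolT Py).
  have [Pz|nPz] := pselect (P z); first by rewrite (asboolT Pz) IH.
  by rewrite (asboolF nPz) (c0 y z t).
elim: s x => //= y s IH x /andP[/asboolP xy ys].
have [Px|nPx] := pselect (P x); last first.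
  have [Py|nPy] := pselect (P y).
    by rewrite (asboolF nPx) (asboolT Py) /= (leq_add (leqnn 1)) ?c1.
  by rewrite (asboolF nPx) (asboolF nPy) IH.
by apply: (@leq_trans 1) => //; apply: (c1 x (y :: s)) => //=; rewrite asboolT.
Qed.

Lemma increasing_map (g : T -> T) x s :
  (forall y z, lt y z -> lt (g y) (g z)) ->
  increasing x s -> increasing (g x) (map g s).
Proof.
move=> gm; elim: s x => //= y s IH x /andP[/asboolP xy /IH ->].
by rewrite andbT; apply/asboolP; exact: gm.
Qed.

Lemma changes_map (g : T -> T) (P Q : set T) x s :
  (forall y, P y <-> Q (g y)) -> changes Q (g x) (map g s) = changes P x s.
Proof.
move=> PQ; elim: s x => //= y s IH x.
by rewrite IH; congr ((_ != _) + _); apply: asbool_equiv_eq; split=> /PQ.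
Qed.

Lemma all_in_map (g : T -> T) (D D' : T -> Prop) s :
  (forall y, D y -> D' (g y)) -> all_in D s -> all_in D' (map g s).
Proof.
move=> DD'; rewrite /all_in all_map; apply: sub_all => y /asboolP h.
by apply/asboolP; exact: DD'.
Qed.

Lemma all_in_sub (D D' : T -> Prop) s :
  (forall y, D y -> D' y) -> all_in D s -> all_in D' s.
Proof. by move=> DD'; apply: sub_all => y /asboolP /DD' /asboolP. Qed.

Lemma all_in_rcons D s y : all_in D (rcons s y) = all_in D s && `[< D y >].
Proof. by rewrite /all_in all_rcons andbC. Qed.

Lemma increasing_rcons x s y :
  increasing x (rcons s y) = increasing x s && `[< lt (last x s) y >].
Proof. exact: rcons_path. Qed.

Lemma all_in_last (D : T -> Prop) x s : D x -> all_in D s -> D (last x s).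
Proof. by elim: s x => //= y s IH x _ /andP[/asboolP Dy /IH]; exact. Qed.

Lemma increasing_last x s : increasing x s -> x = last x s \/ lt x (last x s).
Proof.
elim: s x => [|y s IH] x /=; first by left.
by move=> /andP[/asboolP xy /IH[<-|/(lt_trans xy)]]; right.
Qed.

End Changes.

(** Convex sets change at most twice along any increasing sequence; a definable set is constant on
    whichever of itself and its complement contains [a]. Boolean operations intersect the domains
    and add the bounds. *)
Lemma changes_boolean_combination (L : language) (M : structure L)
    (lt : M -> M -> Prop) (A : set M) (a : M) :
  (forall x y z, lt x y -> lt y z -> lt x z) ->
  boolean_combination [set B : set M | convex lt B \/ definable1 B] A ->
  exists D : set M,
    [/\ definable1 D, D a & exists N, changes_bounded lt D A N].
Proof.
move=> lt_trans; elim=> {A}[A [cA|dA]|A _ [D [dD Da [N hN]]]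
    |A B _ [D [dD Da [N hN]]] _ [D' [dD' Da' [N' hN']]]
    |A B _ [D [dD Da [N hN]]] _ [D' [dD' Da' [N' hN']]]].
- exists setT; split=> //; first exact: definable_True.
  by exists 2 => x s _ _; exact: changes_convex.
- have c0 (P : set M) : (P = A \/ P = ~` A) -> P a ->
      exists D : set M, [/\ definable1 D, D a & exists N, changes_bounded lt D A N].
    move=> PA Pa; exists P; split=> //.
      by case: PA => -> //; exact: definable_not.
    exists 0 => x s Px; rewrite (_ : changes A x s = changes P x s); last first.
      by case: PA => -> //; rewrite changesC.
    elim: s x Px => //= y s IH x Px /andP[/asboolP Py Ps] /andP[_ ys].
    by rewrite !asboolT//= IH.
  have [Aa|nAa] := pselect (A a); first by apply: (c0 A) => //; left.
  by apply: (c0 (~` A)) => //; right.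
- by exists D; split=> //; exists N => x s; rewrite changesC; exact: hN.
- exists (D `&` D'); split=> //; first exact: definable_and.
  exists (N + N') => x s [Dx Dx'] Ds xs.
  apply: leq_trans (changesU _ _ _ _) (leq_add (hN _ _ _ _ _) (hN' _ _ _ _ _)) => //;
  by apply: all_in_sub Ds => y [].
- exists (D `&` D'); split=> //; first exact: definable_and.
  exists (N + N') => x s [Dx Dx'] Ds xs.
  apply: leq_trans (changesI _ _ _ _) (leq_add (hN _ _ _ _ _) (hN' _ _ _ _ _)) => //;
  by apply: all_in_sub Ds => y [].
Qed.

(** * Cuts of a preorder on the realizations of a type *)

Ltac definability :=
  cbn beta;
  lazymatch goal with
  | |- definable (fun w => ~ _) => apply definable_not; definability
  | |- definable (fun w => _ /\ _) => apply definable_and; definability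
  | |- definable (fun w => _ \/ _) => apply definable_or; definability
  | |- definable (fun w => _ <-> _) => apply definable_iff; definability
  | |- definable (fun w => exists _, _) => apply definable_ex; definability
  | |- definable (fun w => _ (w _) (w _) (w _)) => idtac
  | |- definable (fun w => ?R (w ?i) (w ?j)) =>
      apply (@definable_rel2 _ _ _ R i j); try done
  | |- definable (fun w => ?D (w ?i)) => apply (@definable_set1 _ _ _ D i); try done
  | |- definable (fun w => _ -> _) => apply definable_imp; definability
  | |- definable (fun w => forall _, _) => apply definable_all; definability
  | |- _ => idtac
  end.

Section TypeAnalysis.
Variables (L : language) (C : structure L) (lt : C -> C -> Prop).
Hypotheses (mC : monster C) (dlt : definable2 lt) (lt_lin : strict_linear_order lt).

Lemma lt_trans x y z : lt x y -> lt y z -> lt x z.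
Proof. by case: lt_lin => -[_ h] _; exact: h. Qed.

Lemma lt_irr x : ~ lt x x.
Proof. by case: lt_lin => -[h _] _; exact: h. Qed.

Lemma lt_total x y : [\/ lt x y, x = y | lt y x].
Proof. by case: lt_lin. Qed.

Lemma nlt_trans x y z : ~ lt x y -> ~ lt y z -> ~ lt x z.
Proof.
move=> nxy nyz xz; have [xy|xy|yx] := lt_total x y; [exact: nxy|by subst|].
exact/nyz/lt_trans/xz.
Qed.

Lemma lt_asym x y : lt x y -> ~ lt y x.
Proof. by move=> xy /(lt_trans xy); exact: lt_irr. Qed.

Variable a0 : C.

Definition in_type (D : C -> Prop) : Prop := definable1 (M := C) D /\ D a0.

Definition realizes (x : C) : Prop := forall D, in_type D -> D x.

Lemma realizes_refl : realizes a0.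
Proof. by move=> D []. Qed.

Lemma in_typeI D D' : in_type D -> in_type D' -> in_type (D `&` D').
Proof. by move=> [dD Da] [dD' Da']; split=> //; exact: definable_and. Qed.

Lemma realizes_aut g x : automorphism g -> realizes x -> realizes (g x).
Proof.
by move=> ag Xx D tD; apply/(automorphism_definable1 x ag tD.1); exact: Xx tD.
Qed.

(** Every definable set or its complement belongs to the type of [a0], so two realizations satisfy
    the same formulas. The inverse automorphism serves to transport facts back. *)
Lemma realizes_conjugate a b : realizes a -> realizes b ->
  exists g f, [/\ automorphism g, automorphism f, g a = b, cancel g f & cancel f g].
Proof.
move=> Xa Xb; have [|g [ag ga]] := monster_conjugate mC (a := a) (b := b).
  move=> D dD Da; apply: contrapT => nDb.
  have [D0|nD0] := pselect (D a0); first by apply: nDb; exact: Xb.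
  have tnD : in_type (fun x => ~ D x) by split=> //; exact: definable_not.
  exact: Xa tnD Da.
by have [f [af gK fK]] := automorphism_inv ag; exists g, f.
Qed.

(** Compactness for conditions [W D] that strengthen as [D] shrinks in the type of [a0]: approximate
    witnesses yield one realization satisfying all of them. Directedness comes from intersecting the
    sets [D]. *)
Lemma realize_type (k : nat) (v : 'I_k -> C)
    (W : (C -> Prop) -> C -> ('I_k -> C) -> Prop) :
  (forall D, in_type D -> definable
     (fun w : 'I_k.+1 -> C => W D (w ord0) (fun j => w (lift ord0 j)))) ->
  (forall D D' x, (forall y, D y -> D' y) -> W D x v -> W D' x v) ->
  (forall D, in_type D -> exists x, D x /\ W D x v) ->
  exists x, realizes x /\ forall D, in_type D -> W D x v.
Proof.
move=> dW monoW inh.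
pose W' (D : {D : C -> Prop | in_type D}) x w := sval D x /\ W (sval D) x w.
have tT : in_type setT by split=> //; exact: definable_True.
have [|[D tD]|[D tD] [D' tD']|[D tD]|x hx] := @monster_realize _ _ mC _ _ v W'.
- exact: inhabits (exist _ _ tT).
- apply: definable_and; last exact: dW.
  by apply: definable_set1; case: tD.
- exists (exist _ _ (in_typeI tD tD')) => x [/= [Dx Dx'] h].
  by split; split=> //; apply: monoW h => y [].
- exact: inh.
- exists x; split=> [D tD|D tD]; by case: (hx (exist _ D tD)).
Qed.

Lemma realize_pair (W : (C -> Prop) -> C -> C -> C -> Prop) a b :
  (forall n (i j k : 'I_n) D, in_type D ->
     definable (fun w : 'I_n -> C => W D (w i) (w j) (w k))) ->
  (forall D D' x, (forall y, D y -> D' y) -> W D x a b -> W D' x a b) ->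
  (forall D, in_type D -> exists x, D x /\ W D x a b) ->
  exists x, realizes x /\ forall D, in_type D -> W D x a b.
Proof.
move=> dW mW inh.
apply: (@realize_type 2 (fun i => if i == ord0 then a else b)
         (fun D x v => W D x (v ord0) (v ord_max))) => //.
by move=> D tD; exact: dW.
Qed.

(** If each [D] contains a counterexample, its coordinates are replaced by realizations one after
    the other, those still to be chosen ranging over [D] meanwhile. *)
Lemma compactness3 (P : C -> C -> C -> Prop) :
  (forall n (i j k : 'I_n), definable (fun w : 'I_n -> C => P (w i) (w j) (w k))) ->
  (forall x y z, realizes x -> realizes y -> realizes z -> P x y z) ->
  exists D, in_type D /\ forall x y z, D x -> D y -> D z -> P x y z.
Proof.
move=> dP XP; apply: contrapT => nD.
have [||D tD|x [Xx hx]] := @realize_pair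
    (fun D x _ _ => exists y z, D y /\ D z /\ ~ P x y z) a0 a0.
- by move=> n i j k D [tD _]; definability; exact: dP.
- by move=> D D' x DD' [y [z [Dy [Dz h]]]]; exists y, z; split; [|split]; auto.
- apply: contrapT => h; apply: nD; exists D; split=> // x y z Dx Dy Dz.
  by apply: contrapT => nP; apply: h; exists x; split=> //; exists y, z.
have [||D tD|y [Xy hy]] := @realize_pair
    (fun D y x _ => exists z, D z /\ ~ P x y z) x a0.
- by move=> n i j k D [tD _]; definability; exact: dP.
- by move=> D D' y DD' [z [Dz h]]; exists z; split; auto.
- by have [y [z [Dy [Dz h]]]] := hx D tD; exists y; split=> //; exists z.
have [||D tD|z [Xz hz]] := @realize_pair (fun D z x y => ~ P x y z) x y.
- by move=> n i j k D _; definability; exact: dP.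
- by [].
- by have [z [Dz h]] := hy D tD; exists z.
by apply: (hz setT); [split=> //; exact: definable_True|exact: XP].
Qed.

(** * Suprema of cuts inside a class of a convex equivalence *)

Section Preorder.
Variables (le : C -> C -> Prop) (D0 : C -> Prop) (N : nat).
Hypotheses (dle : definable2 le) (le_tp : total_preorder le) (tD0 : in_type D0).
Hypothesis bounded_below : forall a, realizes a ->
  changes_bounded lt D0 (fun x => le x a) N.
Hypothesis bounded_above : forall a, realizes a ->
  changes_bounded lt D0 (fun x => le a x) N.
Variable E : C -> C -> Prop.
Hypotheses (dE : definable2 E) (cE : convex_equivalence lt E).

Lemma le_refl x : le x x.
Proof. by case: le_tp => -[h _] _; exact: h. Qed.

Lemma le_trans x y z : le x y -> le y z -> le x z.
Proof. by case: le_tp => -[_ h] _; exact: h. Qed.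

Let Er x : E x x. Proof. by case: cE => -[h _ _] _; exact: h. Qed.
Let Es x y : E x y -> E y x. Proof. by case: cE => -[_ h _] _; exact: h. Qed.
Let Et x y z : E x y -> E y z -> E x z.
Proof. by case: cE => -[_ _ h] _; exact: h. Qed.

(* [u] is at most the supremum, in [S] and inside the [E]-class of [a], of the
   initial segment of [le] below [a]. *)
Definition reaches (S : C -> Prop) (a u : C) : Prop :=
  exists y, S y /\ E a y /\ ~ lt y u /\ le y a.

Lemma definable_reaches S n (i j : 'I_n) : definable1 (M := C) S ->
  definable (fun w : 'I_n -> C => reaches S (w i) (w j)).
Proof. by move=> dS; rewrite /reaches; definability. Qed.

Lemma reaches_aut g a u : automorphism g ->
  reaches realizes a u -> reaches realizes (g a) (g u).
Proof.
move=> ag [y [Xy [Eay [yu ya]]]]; exists (g y).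
split; first exact: realizes_aut.
split; first exact: (iffLR (automorphism_definable2 _ _ ag dE)).
split; last exact: (iffLR (automorphism_definable2 _ _ ag dle)).
by move=> h; apply: yu; apply: (iffRL (automorphism_definable2 _ _ ag dlt)).
Qed.

Lemma reaches_down S a u u' : ~ lt u u' -> reaches S a u -> reaches S a u'.
Proof.
by move=> uu' [y [Sy [Eay [yu ya]]]]; exists y; do !split=> //; exact: nlt_trans uu'.
Qed.

Lemma reaches_le S a b u : E a b -> le a b -> reaches S a u -> reaches S b u.
Proof.
move=> Eab ab [y [Sy [Eay [yu ya]]]]; exists y; do !split=> //.
  exact: Et (Es Eab) Eay.
exact: le_trans ya ab.
Qed.

Lemma reaches_self (S : C -> Prop) a u :
  S u -> E a u -> le u a -> reaches S a u.
Proof. by move=> Su Eau ua; exists u; do !split=> //; exact: lt_irr. Qed.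

(** A single drop of the supremum would, by conjugacy, occur at every realization, and following
    these drops to the right gives some cut too many changes. *)
Lemma reaches_mono a b u : realizes a -> realizes b -> E b a -> lt b a ->
  reaches realizes b u -> reaches realizes a u.
Proof.
move=> Xa Xb Eba ba bu; apply: contrapT => nau.
(* A drop at [c], phrased so that automorphisms carry it from [b] to every realization. *)
pose Phi c := exists a y, [/\ realizes a, realizes y & E c a] /\
  [/\ lt c a, le y c, E c y & ~ reaches realizes a y].
have Phib : Phi b.
  have [y [Xy [Eby [yu yb]]]] := bu.
  exists a, y; split=> //; split=> // h; apply: nau; exact: reaches_down h.
have {Phib} PhiX c : realizes c -> Phi c.
  move=> Xc; have [g [f [ag af gb gK fK]]] := realizes_conjugate Xb Xc.
  have [d [y [[Xd Xy Ebd] [bd yb Eby nr]]]] := Phib.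
  exists (g d), (g y); rewrite -gb; split; split.
  - exact: realizes_aut.
  - exact: realizes_aut.
  - exact: (iffLR (automorphism_definable2 _ _ ag dE)).
  - exact: (iffLR (automorphism_definable2 _ _ ag dlt)).
  - exact: (iffLR (automorphism_definable2 _ _ ag dle)).
  - exact: (iffLR (automorphism_definable2 _ _ ag dE)).
  - by move=> /(reaches_aut af); rewrite !gK.
(* From [c], move right to some [d] that does not reach [y >= d] with [le y c],
   and start again from [y]: the final element [h] of this walk is [le] every
   starting point but not [le] any of the intermediate [d]. *)
have walk n c : realizes c -> exists h s,
    [/\ realizes h, le h c, E c h & ~ lt h c] /\
    [/\ all_in realizes s, increasing lt c s
      & n <= changes (fun x => le h x) c s].
  elim: n c => [|n IH] c Xc.
    by exists c, [::]; do !split=> //; [exact: le_refl|exact: lt_irr].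
  have [d [y [[Xd Xy Ecd] [cd yc Ecy nr]]]] := PhiX c Xc.
  (* Otherwise [d] itself witnesses that [d] reaches [y]. *)
  have dy : lt d y.
    have [//|edy|yd] := lt_total d y.
      by case: nr; rewrite -edy; apply: reaches_self => //; exact: le_refl.
    by case: nr; exists d; do !split=> //; [exact: lt_asym|exact: le_refl].
  have Edy : E d y by exact: Et (Es Ecd) Ecy.
  have [h [s [[Xh hy Eyh nhy] [Xs ys ns]]]] := IH y Xy.
  exists h, [:: d, y & s]; split; split=> //.
  - exact: le_trans hy yc.
  - exact: Et Ecy Eyh.
  - by move=> hc; apply: nhy; exact: lt_trans (lt_trans hc cd) dy.
  - by rewrite /all_in /= !asboolT.
  - by rewrite /increasing /= !asboolT.
  - rewrite /= (asboolT (le_trans hy yc)) (asboolT hy) asboolF.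
      by rewrite !add1n ltnS leqW.
    by move=> hd; apply: nr; exists h; do !split=> //; exact: Et Edy Eyh.
(* The point [h] depends on the length of the walk, but the bound [N] holds for the cuts at all
   realizations. *)
have [h [s [[Xh _ _ _] [Xs bs ns]]]] := walk N.+1 b Xb.
have := bounded_above Xh (Xb _ tD0) (all_in_sub (fun x Xx => Xx _ tD0) Xs) bs.
by move=> /(leq_trans ns); rewrite ltnn.
Qed.

(** By conjugacy only [a0] matters. If every [D] overshoots, a realization [u] is reached through
    some [y] of [D] in the cut at [a0], while neither [u] nor the previous point [b] is in that cut.
    For [D] too small to reach [b] this gives [u < y < b], so chains inside [D0] grow leftwards with
    ever more changes. *)
Lemma reaches_definable : exists D, in_type D /\
  forall a u, realizes a -> realizes u -> E a u ->
    reaches D a u -> reaches realizes a u.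
Proof.
pose sharp a (D : C -> Prop) := forall u, realizes u -> E a u ->
  reaches D a u -> reaches realizes a u.
suff [D [tD hD]] : exists D, in_type D /\ sharp a0 D.
  exists D; split=> // a u Xa Xu Eau [y [Dy [Eay [yu ya]]]].
  have [g [f [ag af ga gK fK]]] := realizes_conjugate realizes_refl Xa.
  have fa : f a = a0 by rewrite -ga gK.
  have : reaches realizes a0 (f u).
    apply: hD; first exact: realizes_aut.
      by rewrite -fa; apply: (iffLR (automorphism_definable2 _ _ af dE)).
    exists (f y); rewrite -fa; split.
      by apply: (iffLR (automorphism_definable1 _ af tD.1)).
    split; first by apply: (iffLR (automorphism_definable2 _ _ af dE)).
    split; last by apply: (iffLR (automorphism_definable2 _ _ af dle)).
    by move=> h; apply: yu; apply: (iffRL (automorphism_definable2 _ _ af dlt)).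
  by move=> /(reaches_aut ag); rewrite fK ga.
apply: contrapT => nD.
have shrink D : in_type D -> exists u,
    [/\ realizes u, E a0 u, reaches D a0 u & ~ reaches realizes a0 u].
  move=> tD; apply: contrapT => nu; apply: nD; exists D; split=> // u Xu Eau Du.
  by apply: contrapT => nr; apply: nu; exists u.
have walk n : exists u s,
    [/\ realizes u, E a0 u & ~ reaches realizes a0 u] /\
    [/\ all_in D0 s, increasing lt u s & n <= changes (fun x => le x a0) u s].
  elim: n => [|n [b [s [[Xb Eab nb] [Ds bs ns]]]]].
    by have [u [Xu Eau _ nu]] := shrink D0 tD0; exists u, [::].
  (* By compactness, what no realization reaches is already out of reach for some [D]. *)
  have [D [tD nDb]] : exists D, in_type D /\ ~ reaches D a0 b.
    apply: contrapT => allD; apply: nb.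
    have [||D tD|y [Xy hy]] := @realize_pair
      (fun _ y a u => E a y /\ ~ lt y u /\ le y a) a0 b.
    - by move=> m i j k D _; definability.
    - by [].
    - have [y [Dy h]] : reaches D a0 b.
        by apply: contrapT => nr; apply: allD; exists D.
      by exists y.
    - by exists y; split=> //; exact: hy D0 tD0.
  have [u [Xu Eau [y [[Dy D0y] [Eay [yu ya]]]] nu]] := shrink _ (in_typeI tD tD0).
  have nya : ~ le u a0 by move=> h; apply: nu; exact: reaches_self.
  have nba : ~ le b a0 by move=> h; apply: nb; exact: reaches_self.
  have uy : lt u y by have [//|e|//] := lt_total u y; case: nya; rewrite e.
  have yb : lt y b by apply: contrapT => h; apply: nDb; exists y.
  have D0b : D0 b by exact: Xb.
  exists u, [:: y, b & s]; split; split=> //.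
  - by rewrite /all_in /= !asboolT.
  - by rewrite /increasing /= !asboolT.
  - by rewrite /= (asboolF nya) (asboolT ya) (asboolF nba) !add1n ltnS leqW.
have [u [s [[Xu _ _] [Ds us ns]]]] := walk N.+1.
have := bounded_below realizes_refl (Xu _ tD0) Ds us.
by move=> /(leq_trans ns); rewrite ltnn.
Qed.

(** Two points of a class are [F]-equivalent when no cut at a point of [D'] ends between them;
    replacing realizations by [D] and [D'] makes [F] definable. *)
Lemma refinement : exists F,
  [/\ definable2 F, convex_equivalence lt F, (forall x y, F x y -> E x y)
    & forall x y, realizes x -> realizes y -> E x y -> lt x y ->
        (F x y <-> reaches realizes x y)].
Proof.
have [D [tD hD]] := reaches_definable.
have DX a u : reaches realizes a u -> reaches D a u.
  by move=> [y [Xy h]]; exists y; split=> //; exact: Xy.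
have dr n (i j : 'I_n) := definable_reaches i j tD.1.
(* For realizations this is monotonicity: [c] reaches [x] through some [z], and [z] reaches whatever
   [x] does. Compactness extends it to a definable [D']. *)
have [||D' [tD' hD']] := @compactness3 (fun x y c => E x y -> E x c -> lt x y ->
   reaches D x y -> reaches D c x -> reaches D c y).
- move=> n i j k; do !(apply: definable_imp; first by [exact: definable_rel2|exact: dr]).
  exact: dr.
- move=> x y c Xx Xy Xc Exy Exc xy /(hD _ _ Xx Xy Exy) rxy /(hD _ _ Xc Xx (Es Exc)).
  move=> [z [Xz [Ecz [zx zc]]]]; apply: DX.
  have [xz|exz|//] := lt_total x z.
    apply: (reaches_le (Es Ecz) zc); apply: reaches_mono Xz Xx _ xz rxy.
    exact: Et Exc Ecz.
  by apply: (reaches_le Exc) rxy; rewrite exz.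
pose F x y := E x y /\ forall c, D' c -> E x c -> (reaches D c x <-> reaches D c y).
exists F; split.
- rewrite /F; apply: definable_and; first exact: definable_rel2.
  apply: definable_all; apply: definable_imp; first by apply: definable_set1; case: tD'.
  apply: definable_imp; first exact: definable_rel2.
  by apply: definable_iff; exact: dr.
- split=> [|x y z t [Exy hy] [Ext ht] yz zt].
    split=> [x|x y [Exy h]|x y z [Exy hy] [Eyz hz]]; split=> //.
    + exact: Es.
    + by move=> c Dc Eyc; apply: iff_sym; apply: h => //; exact: Et Exy Eyc.
    + exact: Et Exy Eyz.
    + move=> c Dc Exc; rewrite (hy c Dc Exc); apply: hz => //.
      exact: Et (Es Exy) Exc.
  have Exz : E x z by case: cE => _ h; exact: h Exy Ext yz zt.
  split=> // c Dc Exc; split.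
    move=> /(ht c Dc Exc); exact: reaches_down (lt_asym zt).
  by move=> h; apply/(hy c Dc Exc); exact: reaches_down (lt_asym yz) h.
- by move=> x y [].
(* Taking [c] to be [x], which reaches itself, turns [F x y] into reaching [y]. *)
- move=> x y Xx Xy Exy xy; split=> [[_ h]|rxy].
    apply: hD => //; apply/(h x); [exact: Xx|exact: Er|].
    by apply: reaches_self => //; [exact: Xx|exact: le_refl].
  split=> // c D'c Exc; split; last exact: reaches_down (lt_asym xy).
  by apply: hD' => //; [exact: Xx|exact: Xy|exact: DX].
Qed.


(** The measure for the final induction. Counting the changes of both cuts makes it invariant under
    reversing the preorder. *)
Definition chains_bounded (F : C -> C -> Prop) (k : nat) : Prop :=
  forall a s, realizes a -> all_in realizes s -> all_in (F a) s -> increasing lt a s ->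
    changes (fun x => le x a) a s + changes (fun x => le a x) a s <= k.

(** A chain in the [F]-class of [a] can be prolonged in the [E]-class with one more change, by
    ending at a point [b] that [a] does not reach. *)
Lemma refinement_drop F k :
  (forall x y, F x y -> E x y) ->
  (forall x y, realizes x -> realizes y -> lt x y -> F x y -> reaches realizes x y) ->
  (forall a, realizes a ->
     exists b, [/\ realizes b, E a b & ~ reaches realizes a b]) ->
  chains_bounded E k -> 0 < k /\ chains_bounded F k.-1.
Proof.
move=> FE Fr unr bk.
suff drop a s : realizes a -> all_in realizes s -> all_in (F a) s ->
    increasing lt a s ->
    changes (fun x => le x a) a s + changes (fun x => le a x) a s < k.
  have k0 : 0 < k by have := drop a0 [::] realizes_refl isT isT isT; exact: leq_trans.
  by split=> // a s Xa Xs Fs as_; rewrite -ltnS prednK// drop.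
move=> Xa Xs Fs as_; have [b [Xb Eab nab]] := unr a Xa.
have nba : ~ le b a by move=> h; apply: nab; exact: reaches_self.
have below_b z : realizes z -> E a z -> le z a -> lt z b.
  by move=> Xz Eaz za; apply: contrapT => zb; apply: nab; exists z.
have Es' : all_in (E a) s by apply: all_in_sub Fs => y /FE.
have Xz : realizes (last a s) by exact: all_in_last.
have Eaz : E a (last a s) by exact: all_in_last.
(* If the chain ends in the cut, appending [b] leaves the cut. *)
have [za|nza] := pselect (le (last a s) a).
  have zb := below_b _ Xz Eaz za.
  have := bk a (rcons s b) Xa.
  rewrite !all_in_rcons !increasing_rcons Xs Es' as_ !asboolT//.
  move=> /(_ isT isT isT).
  rewrite !changes_rcons (asboolT za) (asboolF nba); apply: leq_trans.
  by rewrite addn1 addSn ltnS leq_add2l leq_addr.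
have az : lt a (last a s).
  have [e|//] := increasing_last lt_trans as_.
  by case: nza; rewrite -e; exact: le_refl.
have Faz : F a (last a s).
  case/lastP: s Fs az {Xs as_ Es' Xz Eaz nza}; first by move=> _ /lt_irr.
  by move=> s z; rewrite last_rcons all_in_rcons => /andP[_ /asboolP].
(* If it ends outside, [a] still reaches its last point, so a point [y] of the cut can be inserted
   before [b]. *)
have [y [Xy [Eay [yz ya]]]] := Fr _ _ Xa Xz az Faz.
have zy : lt (last a s) y.
  by have [//|e|//] := lt_total (last a s) y; case: nza; rewrite e.
have yb := below_b _ Xy Eay ya.
have := bk a (rcons (rcons s y) b) Xa.
rewrite !all_in_rcons !increasing_rcons last_rcons Xs Es' as_ !asboolT//.
move=> /(_ isT isT isT).
rewrite !changes_rcons last_rcons (asboolF nza) (asboolT ya) (asboolF nba).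
apply: leq_trans; rewrite !addn1 !addSn ltnS; apply: leqW.
by rewrite leq_add2l -addnA leq_addr.
Qed.

Lemma reaches_all a b : realizes a -> realizes b ->
  (forall u, realizes u -> E a u -> reaches realizes a u) ->
  forall u, realizes u -> E b u -> reaches realizes b u.
Proof.
move=> Xa Xb h u Xu Ebu.
have [g [f [ag af ga gK fK]]] := realizes_conjugate Xa Xb.
rewrite -ga -(fK u); apply: reaches_aut => //; apply: h; first exact: realizes_aut.
by rewrite -(gK a) ga; apply: (iffLR (automorphism_definable2 _ _ af dE)).
Qed.

End Preorder.

End TypeAnalysis.

(** * Twisted orders *)

Section Twists.
Variable X : Type.
Implicit Types (R E F : X -> X -> Prop) (s : seq (X -> X -> Prop)).

Definition depth s x y : nat := count (fun F => `[< F x y >]) s.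

(** Each relation containing the pair reverses it once, so only the parity of their number counts.
    The default [True] is symmetric, which lets the hypothesis range over all indices. *)
Lemma foldl_twistE s R x y :
  (forall i x y, nth (fun _ _ => True) s i x y -> nth (fun _ _ => True) s i y x) ->
  foldl (@twist X) R s x y <-> if odd (depth s x y) then R y x else R x y.
Proof.
elim: s R => //= F s IH R sym.
have symF u v : F u v -> F v u by exact: (sym 0).
rewrite IH; last by move=> i; exact: (sym i.+1).
rewrite /depth /= -/(depth s x y) oddD oddb /twist.
have [Fxy|nFxy] := pselect (F x y).
  have Fyx := symF _ _ Fxy.
  by rewrite (asboolT Fxy); case: odd => /=; split=> [[[]|[]]|]; try tauto.
have nFyx : ~ F y x by move=> /symF.
by rewrite (asboolF nFxy); case: odd => /=; split=> [[[]|[]]|]; try tauto.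
Qed.

Lemma twists_nth R s :
  twists R (fun i : 'I_(size s) => nth (fun _ _ => True) s i) = foldl (@twist X) R s.
Proof.
have foldl_map (A B C : Type) (f : A -> B -> A) (g : C -> B) z t :
    foldl (fun z i => f z (g i)) z t = foldl f z (map g t).
  by elim: t z => //= c t IH z.
rewrite /twists (foldl_map _ _ _ (@twist X)); congr foldl.
by rewrite (map_comp (nth _ s) val) val_enum_ord map_nth_iota0// take_size.
Qed.

End Twists.

(** * The twisted order on the realizations of one type *)

Section TypeTwist.
Variables (L : language) (C : structure L) (lt : C -> C -> Prop).
Hypotheses (mC : monster C) (dlt : definable2 lt) (lt_lin : strict_linear_order lt).

Lemma definable2_converse (R : C -> C -> Prop) :
  definable2 R -> definable2 (fun x y => R y x).
Proof. exact: (definable_rel2 (R := R) ord_max ord0). Qed.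

(** Inclusions need not be strict: an equivalence may be repeated, so that its two twists cancel. *)
Fixpoint descending (E : C -> C -> Prop) (s : seq (C -> C -> Prop)) : Prop :=
  if s is F :: s' then
    [/\ definable2 F, convex_equivalence lt F, (forall x y, F x y -> E x y)
      & descending F s']
  else True.

Lemma descending_nth E s i : descending E s -> i < size s ->
  definable2 (nth (fun _ _ => True) s i) /\
  convex_equivalence lt (nth (fun _ _ => True) s i).
Proof.
elim: s E i => //= F s IH E [|i] [dF cF _ ds] // si; exact: IH ds si.
Qed.

Lemma descending_sub E s i x y : descending E s -> i.+1 < size s ->
  nth (fun _ _ => True) s i.+1 x y -> nth (fun _ _ => True) s i x y.
Proof.
elim: s E i => //= F s IH E [|i] [_ _ _ ds] si; last exact: IH ds si.
by case: s {IH} ds si => //= G s [_ _ GF _] _; exact: GF.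
Qed.

Lemma descending_depth0 E s x y : descending E s -> ~ E x y -> depth s x y = 0.
Proof.
elim: s E => //= F s IH E [_ _ FE ds] nE.
have nF : ~ F x y by move=> /FE.
by rewrite (asboolF nF) (IH F).
Qed.

Lemma descending_sym E s i x y : descending E s ->
  nth (fun _ _ => True) s i x y -> nth (fun _ _ => True) s i y x.
Proof.
move=> ds; have [/(descending_nth ds)[_ [[_ h _] _]]|si] := ltnP i (size s).
  exact: h.
by rewrite nth_default.
Qed.

Lemma depth_sym E s x y : descending E s -> depth s x y = depth s y x.
Proof.
elim: s E => //= F s IH E [_ [[_ symF _] _] _ ds].
rewrite (IH _ ds); congr (nat_of_bool _ + _).
by apply: asbool_equiv_eq; split; exact: symF.
Qed.

Lemma descending_twisted E s : descending E s ->
  twisted_orders lt (foldl (@twist C) lt s).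
Proof.
move=> ds; exists (size s), (fun i => nth (fun _ _ => True) s i); split.
- by move=> j; case: (descending_nth ds (ltn_ord j)).
- by move=> j; case: (descending_nth ds (ltn_ord j)).
- move=> i j x y ij; rewrite ij; apply: descending_sub ds _.
  by rewrite -ij.
- by rewrite twists_nth.
Qed.

Lemma definable_foldl_twist E s R : definable2 R -> descending E s ->
  definable2 (foldl (@twist C) R s).
Proof.
elim: s E R => //= F s IH E R dR [dF _ _ ds]; apply: IH ds.
by rewrite /definable2 /twist; definability.
Qed.

Variable a0 : C.
Notation realizes := (realizes a0).

Definition cuts_bounded (le : C -> C -> Prop) (D0 : C -> Prop) (N : nat) : Prop :=
  forall a, realizes a -> changes_bounded lt D0 (fun x => le x a) N
                       /\ changes_bounded lt D0 (fun x => le a x) N.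

(** If [x < y] and [le y x], then [y] itself shows that [x] reaches [y]; hence outside [F] the
    preorder follows [lt]. By conjugacy, one realization that fails to reach all of its class makes
    all of them fail, and the measure drops. *)
Lemma refinement_step le D0 N E k :
  definable2 le -> total_preorder le -> in_type a0 D0 -> cuts_bounded le D0 N ->
  definable2 E -> convex_equivalence lt E -> chains_bounded lt a0 le E k ->
  (exists2 a, realizes a &
     ~ forall b, realizes b -> E a b -> reaches lt le E realizes a b) ->
  exists F,
  [/\ definable2 F, convex_equivalence lt F, (forall x y, F x y -> E x y),
      (forall x y, realizes x -> realizes y -> E x y -> lt x y -> ~ F x y -> ~ le y x)
    & 0 < k /\ chains_bounded lt a0 le F k.-1].
Proof.
move=> dle tle tD0 bd dE cE bk [a Xa na].
have [F [dF cF FE hF]] := refinement mC dlt lt_lin dle tle tD0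
  (fun c Xc => (bd c Xc).1) (fun c Xc => (bd c Xc).2) dE cE.
exists F; split=> //.
- move=> x y Xx Xy Exy xy nF yx; apply: nF; apply/hF => //.
  exact: reaches_self.
- apply: refinement_drop bk => //.
    by move=> x y Xx Xy xy Fxy; apply/hF => //; exact: FE.
  move=> c Xc; apply: contrapT => nb; apply: na => b Xb Eab.
  apply: (reaches_all mC dlt dle dE Xc Xa) Eab => // u Xu Ecu.
  by apply: contrapT => nr; apply: nb; exists u.
Qed.

(** If [y] were strictly above [x] in the preorder, points below [x] and points above [y] would both
    occur arbitrarily far right in the class, and the cut at [x] would change without bound. *)
Lemma unbounded_equiv le D0 N E :
  total_preorder le -> in_type a0 D0 -> cuts_bounded le D0 N ->
  convex_equivalence lt E ->
  (forall a, realizes a ->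
     forall b, realizes b -> E a b -> reaches lt le E realizes a b) ->
  (forall a, realizes a -> forall b, realizes b -> E a b ->
     reaches lt (fun x y => le y x) E realizes a b) ->
  forall x y, realizes x -> realizes y -> E x y -> le y x.
Proof.
move=> [[le_r le_t] tle] tD0 bd [[Er Es Et] _] down up x y Xx Xy Exy.
apply: contrapT => nyx.
have walk n p : realizes p -> E x p -> exists s,
    [/\ all_in realizes s, increasing lt p s & n <= changes (fun z => le z x) p s].
  elim: n p => [|n IH] p Xp Exp; first by exists [::].
  suff [q [Xq Exq pq lab]] : exists q, [/\ realizes q, E x q, lt p q
      & `[< le p x >] != `[< le q x >]].
    have [s [Xs qs ns]] := IH q Xq Exq; exists (q :: s); split.
    - by rewrite /all_in /= asboolT.
    - by rewrite /increasing /= asboolT.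
    - by rewrite /= lab add1n.
  have [px|npx] := pselect (le p x); last first.
    have [q [Xq [Exq [qp qx]]]] := down x Xx p Xp Exp.
    exists q; split=> //; last by rewrite (asboolF npx) (asboolT qx).
    by have [//|e|//] := lt_total lt_lin p q; case: npx; rewrite e.
  have [q [Xq [Eyq [qp yq]]]] := up y Xy p Xp (Et _ _ _ (Es _ _ Exy) Exp).
  have nqx : ~ le q x by move=> qx; apply: nyx; exact: le_t yq qx.
  exists q; split=> //; [exact: Et _ _ _ Exy Eyq| |by rewrite (asboolT px) (asboolF nqx)].
  by have [//|e|//] := lt_total lt_lin p q; case: nqx; rewrite -e.
have [s [Xs ps ns]] := walk N.+1 x Xx (Er x).
have := (bd x Xx).1 x s (Xx _ tD0) (all_in_sub (fun z Xz => Xz _ tD0) Xs) ps.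
by move=> /(leq_trans ns); rewrite ltnn.
Qed.

(** Induction on the measure [k], refining [E] through [le] or through its reverse as long as one of
    them has a cut that stops short inside a class. *)
Lemma twist_on_type le D0 N k E :
  definable2 le -> total_preorder le -> in_type a0 D0 -> cuts_bounded le D0 N ->
  definable2 E -> convex_equivalence lt E -> chains_bounded lt a0 le E k ->
  exists s, descending E s /\
    forall x y, realizes x -> realizes y -> E x y -> lt x y ->
      ~ (le x y /\ le y x) -> (le x y <-> ~~ odd (depth s x y)).
Proof.
move=> dle tle tD0 bd.
pose ge x y := le y x.
have dge : definable2 ge by exact: definable2_converse.
have [[le_r le_t] le_tot] := tle.
have tge : total_preorder ge.
  by split=> [|x y]; [split=> [//|x y z xy yz]; exact: le_t yz xy|exact: le_tot].
have bge : cuts_bounded ge D0 N by move=> a Xa; case: (bd a Xa).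
have bkge F m : chains_bounded lt a0 le F m <-> chains_bounded lt a0 ge F m.
  by split=> h a s Xa Xs Fs as_; rewrite addnC; exact: h.
elim/ltn_ind: k E => k IH E dE cE bk.
have [unb|bnd_le] := pselect (forall a, realizes a ->
    forall b, realizes b -> E a b -> reaches lt le E realizes a b); last first.
  have [|F [dF cF FE out [k0 bF]]] :=
    refinement_step dle tle tD0 bd dE cE bk.
    apply: contrapT => nex; apply: bnd_le => a Xa; apply: contrapT => na.
    by apply: nex; exists a.
  have [|s [ds hs]] := IH k.-1 _ F dF cF bF; first by rewrite prednK.
  (* Outside [F] nothing is twisted and [le] follows [lt]; inside [F] the two copies cancel, leaving
     the twists of [s]. *)
  exists [:: F, F & s]; split=> // x y Xx Xy Exy xy nxy.
  have [Fxy|nFxy] := pselect (F x y).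
    by rewrite hs// /depth /= (asboolT Fxy) addnA addn1 /= negbK.
  rewrite /depth /= -/(depth s x y) (asboolF nFxy) (descending_depth0 ds nFxy).
  by split=> // _; case: (le_tot x y) => // /(out _ _ Xx Xy Exy xy nFxy).
have [unb'|bnd_ge] := pselect (forall a, realizes a ->
    forall b, realizes b -> E a b -> reaches lt ge E realizes a b); last first.
  have [|F [dF cF FE out [k0 bF]]] :=
    refinement_step dge tge tD0 bge dE cE (iffLR (bkge _ _) bk).
    apply: contrapT => nex; apply: bnd_ge => a Xa; apply: contrapT => na.
    by apply: nex; exists a.
  have [|s [ds hs]] := IH k.-1 _ F dF cF (iffRL (bkge _ _) bF).
    by rewrite prednK.
  (* Outside [F] the preorder is opposite to [lt], hence one twist by [E]; inside [F] the twist by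
     [F] undoes it. *)
  exists [:: E, F & s]; split=> // x y Xx Xy Exy xy nxy.
  rewrite /depth /= -/(depth s x y) (asboolT Exy).
  have [Fxy|nFxy] := pselect (F x y).
    by rewrite hs// (asboolT Fxy) addnA addn1 /= negbK.
  rewrite (asboolF nFxy) (descending_depth0 ds nFxy).
  by split=> //; case/(out _ _ Xx Xy Exy xy nFxy).
(* Here all realizations in one [E]-class are equivalent, so no pair remains to be ordered. *)
exists [::]; split=> // x y Xx Xy Exy xy [].
have Eyx : E y x by case: cE => -[_ Es _] _; exact: Es.
by split; exact: (unbounded_equiv tle tD0 bd cE unb unb').
Qed.

Lemma definable_with_parametersl (R : C -> C -> Prop) a : definable2 R ->
  definable_with_parameters (fun x => R x a).
Proof.
move=> [phi hphi]; exists 1, (fun=> a), phi => x; rewrite -hphi scons0.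
have -> : ord_max = lift ord0 ord0 :> 'I_2 by exact: val_inj.
by rewrite /scons liftK.
Qed.

(** Weak quasi-o-minimality bounds the cut at the single point [a0]; automorphisms give every
    realization the same bound on the same [D]. *)
Lemma changes_bounded_conjugate (R : C -> C -> Prop) D N a :
  definable2 R -> in_type a0 D -> changes_bounded lt D (fun x => R x a0) N ->
  realizes a -> changes_bounded lt D (fun x => R x a) N.
Proof.
move=> dR tD bN Xa x s Dx Ds xs.
have [g [f [ag af ga gK fK]]] := realizes_conjugate mC (@realizes_refl _ _ a0) Xa.
have e y : R y a <-> R (f y) a0.
  by have := automorphism_definable2 y a af dR; rewrite -{2}ga gK.
rewrite -(changes_map (g := f) (Q := fun x => R x a0) _ _ e).
apply: bN.
- by apply: (iffLR (automorphism_definable1 _ af tD.1)).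
- by apply: all_in_map Ds => y; apply: (iffLR (automorphism_definable1 _ af tD.1)).
- apply: increasing_map xs => y z.
  by apply: (iffLR (automorphism_definable2 _ _ af dlt)).
Qed.

End TypeTwist.

(** * From one type to a finite definable partition *)

Section Main.
Variables (L : language) (T : theory L) (C : structure L) (lt : formula L 2)
  (le : C -> C -> Prop).
Hypotheses (CT : model C T) (mC : monster C)
  (lt_lin : strict_linear_order (relation_of (M := C) lt))
  (wT : weakly_quasi_o_minimal T lt)
  (dle : definable2 le) (tle : total_preorder le).
Notation ltC := (relation_of (M := C) lt).

Definition twisted_on (D : C -> Prop) (S : C -> C -> Prop) : Prop :=
  forall x y, D x -> D y ->
    (le x y <-> preorder_equiv le x y \/ (~ preorder_equiv le x y /\ S x y)).

Lemma twisted_near (a : C) : exists D S,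
  [/\ definable1 (M := C) D, D a, twisted_orders ltC S & twisted_on D S].
Proof.
have dlt : definable2 ltC by exact: definable_relation_of.
have lt_t := lt_trans lt_lin.
have fin (R : C -> C -> Prop) : definable2 R -> exists D, in_type a D /\
    exists N, changes_bounded ltC D (fun x => R x a) N.
  move=> dR; have := wT CT (definable_with_parametersl a dR).
  by move=> /(changes_boolean_combination a lt_t)[D [dD Da bD]]; exists D.
have dge : definable2 (fun x y => le y x) by exact: definable2_converse.
have [D1 [tD1 [N1 b1]]] := fin _ dle; have [D2 [tD2 [N2 b2]]] := fin _ dge.
have tD := in_typeI tD1 tD2.
have bd : cuts_bounded ltC a le (D1 `&` D2) (N1 + N2).
  move=> c Xc; split.
    move=> x s [Dx _] Ds xs; apply: leq_trans (leq_addr _ _).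
    apply: (changes_bounded_conjugate mC dlt dle tD1 b1 Xc) => //.
    by apply: all_in_sub Ds => y [].
  move=> x s [_ Dx] Ds xs; apply: leq_trans (leq_addl _ _).
  apply: (changes_bounded_conjugate mC dlt dge tD2 b2 Xc) => //.
  by apply: all_in_sub Ds => y [].
have cE : convex_equivalence ltC (fun _ _ => True) by [].
(* The induction starts from a single class, the whole structure; [k] adds the bounds [N1 + N2] for
   the two cuts. *)
have [|||s [ds hs]] := twist_on_type mC dlt lt_lin dle tle tD bd
    (E := fun _ _ => True) (k := N1 + N2 + (N1 + N2)).
- exact: definable_True.
- exact: cE.
- move=> c s Xc Xs _ cs; have [h1 h2] := bd c Xc.
  have Ds : all_in (D1 `&` D2) s by apply: all_in_sub Xs => y; exact.
  by apply: leq_add; [exact: h1 (Xc _ tD) Ds cs|exact: h2 (Xc _ tD) Ds cs].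
pose S := foldl (@twist C) ltC s.
have dS : definable2 S by exact: definable_foldl_twist ds.
have SE x y := foldl_twistE ltC x y (fun i x y => descending_sym ds).
have [[le_r _] le_tot] := tle.
have XS x y : realizes a x -> realizes a y ->
    (le x y <-> preorder_equiv le x y \/ (~ preorder_equiv le x y /\ S x y)).
  move=> Xx Xy; have [exy|nexy] := pselect (preorder_equiv le x y).
    by case: (exy) => xy _; split=> // _; left.
  suff -> : S x y <-> le x y by split=> [xy|[|[]]//]; right.
  rewrite /S SE; have [xy|exy|yx] := lt_total lt_lin x y.
  - by rewrite hs//; case: odd; split=> // /(lt_asym lt_lin xy).
  - by case: nexy; rewrite exy; split.
  (* The description of [le] covers only increasing pairs, so it is applied to [y] and [x] and
     carried over by totality and the symmetry of [depth]. *)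
  - have neyx : ~ preorder_equiv le y x by move=> [? ?]; apply: nexy.
    have := hs y x Xy Xx I yx neyx; rewrite (depth_sym _ _ ds).
    have : le x y <-> ~ le y x.
      by split=> [xy yx'|nyx]; [exact: nexy|case: (le_tot x y)].
    case: odd => /= -> h; split=> //.
    + by move=> _ /h.
    + by move=> /(lt_asym lt_lin yx).
    + by move=> nyx; case: nyx; apply/h.
(* The agreement, known on realizations only, spreads to a definable neighbourhood of [a]. *)
have [||D [[dD Da] hD]] := compactness3 mC (a0 := a) (P := fun x y _ =>
   le x y <-> preorder_equiv le x y \/ (~ preorder_equiv le x y /\ S x y)).
- by move=> n i j k; rewrite /preorder_equiv; definability.
- by move=> x y _ Xx Xy _; exact: XS.
exists D, S; split=> //; first exact: descending_twisted ds.
by move=> x y Dx Dy; exact: (hD x y x).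
Qed.

Definition good (D : set C) : Prop :=
  definable1 D /\ exists2 S, twisted_orders ltC S & twisted_on D S.

(** Otherwise the complements of finite unions of good sets form a directed definable family of
    nonempty sets; a common point lies in no good set, against [twisted_near]. *)
Lemma good_cover : exists s : seq (set C),
  (forall D, List.In D s -> good D) /\ forall x, exists2 D, List.In D s & D x.
Proof.
apply: contrapT => ncover.
pose I := {s : seq (set C) | forall D, List.In D s -> good D}.
pose W (s : I) x (_ : 'I_0 -> C) := forall D, List.In D (sval s) -> ~ D x.
have nil_good D : List.In D [::] -> good D by case.
have [c] := carrier_inhabited C.
have [|[s gs]|[s gs] [t gt]|[s gs]|x hx] :=
  @monster_realize _ _ mC I 0 (fun=> c) W.
- exact: inhabits (exist _ [::] nil_good).
- rewrite /W /=; elim: s gs => [|D s IH] gs.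
    apply: (@definable_ext _ _ _ (fun=> True)); last exact: definable_True.
    by move=> v; split.
  apply: (@definable_ext _ _ _ (fun w => ~ D (w ord0) /\
      forall D', List.In D' s -> ~ D' (w ord0))).
    move=> v; split=> [[nD h] D' [<-//|]|h]; first exact: h.
    by split=> [|D' sD']; apply: h; [left|right].
  apply: definable_and; last by apply: IH => D' sD'; apply: gs; right.
  by apply/definable_not/definable_set1; case: (gs D); first by left.
- have gst D : List.In D (s ++ t) -> good D.
    by move=> h; have [/gs|/gt] := List.in_app_or _ _ _ h.
  exists (exist _ _ gst) => x h; split=> D sD; apply: h; apply: List.in_or_app;
    [left|right]; exact: sD.
- apply: contrapT => nx; apply: ncover; exists s; split=> // x.
  apply: contrapT => h; apply: nx; exists x => D sD Dx; apply: h.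
  by exists D.
have [D [S [dD Dx tS oS]]] := twisted_near x.
have gD D' : List.In D' [:: D] -> good D' by case=> // <-; split=> //; exists S.
by apply: (hx (exist _ _ gD) D) => //; left.
Qed.

(** Definable subsets of good sets are good, so each set can be cut down to what the pieces built so
    far leave uncovered. *)
Lemma good_partition (s : seq (set C)) : (forall D, List.In D s -> good D) ->
  exists n (D : 'I_n -> set C),
    [/\ forall i, good (D i), trivIset setT D, forall i, D i !=set0
      & \bigcup_i D i = [set x | exists2 D, List.In D s & D x]].
Proof.
elim: s => [|A s IH] gs.
  exists 0, (fun=> set0); split; [by case|by move=> []|by case|].
  by apply/seteqP; split=> x [] // [].
have [|n [D [gD tD D0 UD]]] := IH; first by move=> B sB; apply: gs; right.
pose B := A `\` \bigcup_i D i.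
(* An empty remainder is dropped, since the blocks must be nonempty. *)
have [B0|/set0P Bn0] := eqVneq B set0.
  exists n, D; split=> //; rewrite /cover UD; apply/seteqP; split=> x /= [E sE Ex].
    by exists E => //; right.
  case: sE => [AE|sE]; last by exists E.
  have : (\bigcup_i D i) x.
    apply: contrapT => nU; have : B x by split=> //; rewrite AE.
    by rewrite B0.
  by rewrite UD.
have dU : definable1 (\bigcup_i D i).
  have h (t : seq 'I_n) :
      definable (fun v : 'I_1 -> C => exists2 i, i \in t & D i (v ord0)).
    elim: t => [|i t IHt].
      by apply: definable_ext (definable_False _ _) => v; split=> // -[].
    apply: definable_ext (definable_or (gD i).1 IHt) => v; split.
      case=> [Div|[j jt Djv]]; first by exists i; rewrite ?mem_head.
      by exists j => //; rewrite inE jt orbT.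
    by move=> [j]; rewrite inE => /predU1P[->|jt] Djv; [left|right; exists j].
  apply: definable_ext (h (enum 'I_n)) => v; split=> [[i _ Di]|[i _ Di]].
    by exists i.
  by exists i; rewrite ?mem_enum.
have gB : good B.
  have [dA [S tS oS]] := gs A (or_introl erefl).
  split; first by apply: definable_and => //; exact: definable_not.
  by exists S => // x y [Ax _] [Ay _]; exact: oS.
pose D' (i : 'I_n.+1) := if unlift ord0 i is Some j then D j else B.
exists n.+1, D'; split.
- by move=> i; rewrite /D'; case: unliftP => [j|] _.
- move=> i j _ _; rewrite /D'.
  case: (unliftP ord0 i) => [i' ->|->]; case: (unliftP ord0 j) => [j' ->|->] //.
  + by move=> /(tD _ _ I I) ->.
  + by move=> [x [Dx [_ nU]]]; case: nU; exists i'.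
  + by move=> [x [[_ nU] Dx]]; case: nU; exists j'.
- by move=> i; rewrite /D'; case: unliftP => [j|] _.
- apply/seteqP; split=> x.
    move=> [i _]; rewrite /D'; case: unliftP => [j _ Dx|_ [Ax _]].
      have : (\bigcup_i D i) x by exists j.
      by rewrite UD => -[E sE Ex]; exists E => //; right.
    by exists A => //; left.
  move=> [E [<-|sE] Ex].
    have [[j _ Dx]|nU] := pselect ((\bigcup_i D i) x).
      by exists (lift ord0 j) => //; rewrite /D' liftK.
    by exists ord0 => //; rewrite /D' unlift_none.
  have : (\bigcup_i D i) x by rewrite UD; exists E.
  by move=> [j _ Dx]; exists (lift ord0 j) => //; rewrite /D' liftK.
Qed.

End Main.

Theorem theorem3p5 (L : language) (T : theory L) (C : structure L)
    (lt : formula L 2) (le : C -> C -> Prop) :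
  complete_theory T -> model C T -> monster C ->
  strict_linear_order (relation_of (M := C) lt) ->
  weakly_quasi_o_minimal T lt ->
  definable2 le -> total_preorder le ->
  exists (n : nat) (D : 'I_n -> set C) (ltE : 'I_n -> C -> C -> Prop),
    [/\ forall i, definable1 (D i),
        classical_sets.partition [set: 'I_n] D [set: C],
        forall i, twisted_orders (relation_of (M := C) lt) (ltE i),
        forall i x y, D i x -> D i y ->
          (le x y <-> preorder_equiv le x y \/
                      (~ preorder_equiv le x y /\ ltE i x y))
      & linear_order le ->
        forall i x y, D i x -> D i y -> (le x y <-> x = y \/ ltE i x y)].
Proof.
move=> _ CT mC lt_lin wT dle tle.
have [s [gs cov]] := good_cover CT mC lt_lin wT dle tle.
have [n [D [gD tD D0 UD]]] := good_partition gs.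
have /choice[ltE hE] i : exists S,
    twisted_orders (relation_of (M := C) lt) S /\ twisted_on le (D i) S.
  by have [_ [S tS oS]] := gD i; exists S.
have agree i x y : D i x -> D i y -> (le x y <-> preorder_equiv le x y \/
    (~ preorder_equiv le x y /\ ltE i x y)) by exact: (hE i).2.
exists n, D, ltE; split=> //.
- by move=> i; case: (gD i).
- split=> //; rewrite /cover UD; apply/seteqP; split=> // x _; exact: cov.
- by move=> i; case: (hE i).
(* Antisymmetry reduces the equivalence of the preorder to equality. *)
- move=> [[[le_r _] _] anti] i x y Dx Dy; split.
    move=> /(agree i x y Dx Dy)[[xy yx]|[_ xy]]; last by right.
    by left; exact: anti.
  move=> [->|xy]; first exact: le_r.
  apply/(agree i x y Dx Dy).
  by have [e|ne] := pselect (preorder_equiv le x y); [left|right].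
Qed.
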